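(* Let $d\ge2$, and let $|\psi\rangle,|\phi\rangle\in\mathbb{C}^d$ be unit vectors with $|\langle\psi|\phi\rangle|^2=c$. For a projective measurement $\{E_k\}$ on the $N+M$ qudits let $$F(c)=\int_{SU(d)}dU\sum_k\left|\langle\Psi_U|E_k|\Psi_U\rangle\right|^2,\qquad |\Psi_U\rangle=U^{\otimes(N+M)}\,|\psi\rangle^{\otimes N}\otimes|\phi\rangle^{\otimes M},$$ be the average post-measurement fidelity with the initial state. Then, for $M\ge N\ge1$, the optimal overlap measurement $\{\Pi_J\}_J$ has $$F_{\rm op}(c)=\sum_{J=J_{\min}}^{J_{\max}}p(J|c)^2,$$ where $p(J|c)=\langle\Psi_{\mathbb 1}|\Pi_J|\Psi_{\mathbb 1}\rangle$, and for $M=N$ the swap test performed on each of the $N$ pairs of copies has $$F_{\rm sw}(c)=\left(\frac{1+c^2}{2}\right)^N .$$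
   Context: By Schur–Weyl duality $(\mathbb{C}^d)^{\otimes(N+M)}\cong\bigoplus_Y\mathcal{U}^{(Y)}(SU(d))\otimes\mathcal{U}^{(Y)}(S_{N+M})$; $\Pi_J$ is the orthogonal projector onto the block of the Young diagram with rows $(J_{\max}+J,\,J_{\max}-J)$, where $J_{\min}=\frac{M-N}{2}$, $J_{\max}=\frac{M+N}{2}$ and $J$ runs in unit steps. The swap test on a pair of qudits (one copy of each state) is the projective measurement onto the symmetric and antisymmetric subspaces of $\mathbb{C}^d\otimes\mathbb{C}^d$; for $M=N$, the $N$ swap tests act separately on the $N$ pairs consisting of one copy of $|\psi\rangle$ and one copy of $|\phi\rangle$, the measurement operators being the $2^N$ tensor products of the single-pair projectors. $dU$ is the normalized Haar measure. *)

(* Defs.v *)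
From HB Require Import structures.
From mathcomp Require Import all_boot all_order all_fingroup all_algebra.
From mathcomp Require Import spectral sesquilinear complex.
From mathcomp Require Import all_classical all_reals all_analysis.
From mathcomp Require Import ring.

Set Implicit Arguments.
Unset Strict Implicit.
Unset Printing Implicit Defensive.

Import Order.TTheory GRing.Theory Num.Theory Num.Def.
Import Normc.

Local Open Scope classical_set_scope.
Local Open Scope ring_scope.

(* [hilb C I] is the Hilbert space with orthonormal basis indexed by [I]:
   C^d is [hilb C 'I_d], C^d (x) C^d is [hilb C ('I_d * 'I_d)%type], and
   (C^d)^{(x) n} is [hilb C {ffun 'I_n -> 'I_d}]. *)
Notation hilb C I := {ffun I -> C^o}.

(* The library's sesquilinear forms are linear in the first argument, so that
   <u|v>, linear in v, is [hdot v u]. *)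
Definition hdot (C : numClosedFieldType) (I : finType) (u v : hilb C I) : C :=
  \sum_x (u x : C) * (v x : C)^*.

Section HDot.
Variables (C : numClosedFieldType) (I : finType).
Local Notation H := (hilb C I).

Fact hdot_linearl (v : H) : linear_for *%R ((@hdot C I)^~ v : H -> C).
Proof.
move=> a u w; rewrite /hdot mulr_sumr -big_split /=; apply: eq_bigr => x _.
by rewrite !ffunE mulrDl mulrA.
Qed.

Fact hdot_linearr (u : H) : linear_for (conjC \; *%R) (@hdot C I u).
Proof.
move=> a v w; rewrite /hdot /= mulr_sumr -big_split /=; apply: eq_bigr => x _.
by rewrite !ffunE rmorphD rmorphM mulrDr mulrCA.
Qed.

HB.instance Definition _ := bilinear_isBilinear.Build C H H C
  *%R (conjC \; *%R) (@hdot C I) (hdot_linearl, hdot_linearr).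

Fact hdot_herm (u v : H) : hdot u v = (-1) ^+ false * (hdot v u)^*.
Proof.
rewrite expr0 mul1r /hdot rmorph_sum; apply: eq_bigr => x _.
by rewrite rmorphM [RHS]mulrC; congr (_ * _); exact/esym/conjCK.
Qed.

HB.instance Definition _ := isHermitianSesquilinear.Build C H false conjC
  (@hdot C I) hdot_herm.

Fact hdot_gt0 (u : H) : u != 0 -> 0 < hdot u u.
Proof.
have ge0 (x : I) : 0 <= (u x : C) * (u x)^* by exact: mul_conjC_ge0.
move=> u0; rewrite lt_neqAle sumr_ge0 ?andbT; last by move=> x _; exact: ge0.
apply: contra_neq u0 => /esym/eqP.
rewrite psumr_eq0; last by move=> x _; exact: ge0.
move=> /allP u0; apply/ffunP => x; rewrite ffunE; apply/eqP.
by have := u0 x (mem_index_enum x); rewrite /= mul_conjC_eq0.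
Qed.

HB.instance Definition _ := isDotProduct.Build C H (@hdot C I) hdot_gt0.

End HDot.

Definition braket (C : numClosedFieldType) (I : finType) (u v : hilb C I) : C :=
  hdot v u.

Definition orth_proj (C : numClosedFieldType) (I : finType)
    (W : {vspace hilb C I}) : 'End(hilb C I) :=
  daddv_pi W (orthov (@hdot C I) W).

Section OrthProj.
Variables (C : numClosedFieldType) (I : finType) (W : {vspace hilb C I}).
Local Notation W' := (orthov (@hdot C I) W).

Fact orthov_cap : (W :&: W' = 0)%VS.
Proof.
apply/eqP; rewrite -subv0; apply/subvP => u; rewrite memv_cap => /andP[uW].
by move=> /mem_orthovP/(_ u uW)/eqP; rewrite dnorm_eq0 memv0.
Qed.

Fact orthov_add : (W + W' = fullv)%VS.
Proof.
apply/eqP; rewrite eqEsubv subvf; apply/subvP => u _.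
have [X XW [Y [-> _ oY]]] := orthogonal_split (@hdot C I) (vbasis W) u.
rewrite (span_basis (vbasisP W)) in XW; apply: memv_add => //.
by move: oY; rewrite orthogonalE (span_basis (vbasisP W)) span_seq1 -memvE.
Qed.

(* [orth_proj W] is the self-adjoint idempotent with image W. *)
Lemma orth_projP : [/\ limg (orth_proj W) = W,
  {in W, forall u, orth_proj W u = u} &
  forall u v, braket (orth_proj W u) v = braket u (orth_proj W v)].
Proof.
have PW u : u \in W -> orth_proj W u = u by exact/daddv_pi_id/orthov_cap.
split=> //.
  apply/eqP; rewrite eqEsubv; apply/andP; split; apply/subvP => u.
    by case/memv_imgP => v _ ->; exact: memv_pi.
  by move=> uW; apply/memv_imgP; exists u; rewrite ?memvf ?PW.
have dec u : exists2 w, w \in W' & u = orth_proj W u + w.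
  exists (daddv_pi W' W u); first exact: memv_pi.
  by rewrite daddv_pi_add ?orthov_cap ?orthov_add ?memvf.
move=> u v; have [u' u'W uE] := dec u; have [v' v'W vE] := dec v.
rewrite /braket [in LHS]vE [in RHS]uE linearDl linearDr /=.
have -> : hdot v' (orth_proj W u) = 0.
  by move/mem_orthovP: v'W; apply; exact: memv_pi.
suff -> : hdot (orth_proj W v) u' = 0 by rewrite !addr0.
apply/eqP; rewrite (herm_eq0C (@hdot C I)); apply/eqP.
by move/mem_orthovP: u'W; apply; exact: memv_pi.
Qed.

End OrthProj.

(* The operator with matrix elements <x|A|y> = k x y. *)
Definition kerop (C : numClosedFieldType) (I : finType) (k : I -> I -> C) :
    'End(hilb C I) :=
  linfun (fun v : hilb C I => [ffun x => \sum_y k x y * v y] : hilb C I).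

Section Registers.
Variables (C : numClosedFieldType) (d n : nat).
Local Notation reg := (hilb C {ffun 'I_n -> 'I_d}).

Definition tensor_pow (U : 'M[C]_d) : 'End(reg) :=
  kerop (fun x y : {ffun 'I_n -> 'I_d} => \prod_i U (x i) (y i)).

(* The permutation of tensor factors moving the factor at site i to site
   s i. *)
Definition perm_op (s : 'S_n) : 'End(reg) :=
  linfun (fun v : reg => [ffun x : {ffun 'I_n -> 'I_d} => v [ffun i => x (s i)]] : reg).

(* A filling of the Young diagram with row lengths [sh] (where sumn sh = n) by
   the sites 0, ..., n-1, given as the map sending a site to the
   (row, column) coordinates of its box. *)
Definition is_tableau (sh : seq nat) (t : {ffun 'I_n -> 'I_n * 'I_n}) : bool :=
  injectiveb t && [forall k, ((t k).2 < nth 0 sh (t k).1)%N].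

Definition row_stab (t : {ffun 'I_n -> 'I_n * 'I_n}) : {set 'S_n} :=
  [set s : 'S_n | [forall k, (t (s k)).1 == (t k).1]].

Definition col_stab (t : {ffun 'I_n -> 'I_n * 'I_n}) : {set 'S_n} :=
  [set s : 'S_n | [forall k, (t (s k)).2 == (t k).2]].

Definition young_sym (t : {ffun 'I_n -> 'I_n * 'I_n}) : 'End(reg) :=
  ((\sum_(s in row_stab t) perm_op s) \o
   (\sum_(s in col_stab t) (-1) ^+ (odd_perm s) *: perm_op s))%VF.

(* The block U^(Y)(SU(d)) (x) U^(Y)(S_n) of the Schur-Weyl decomposition of
   (C^d)^{(x) n}: each tableau t of shape Y contributes a copy
   limg (young_sym t) of the irreducible U^(Y)(SU(d)), and these copies span
   the block. *)
Definition schur_weyl_block (sh : seq nat) : {vspace reg} :=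
  (\sum_(t | is_tableau sh t) limg (young_sym t))%VS.

End Registers.

Section SwapTest.
Variables (C : numClosedFieldType) (d : nat).
Local Notation pair := ('I_d * 'I_d)%type.

Definition swap_op : 'End(hilb C pair) :=
  linfun (fun v : hilb C pair => [ffun x : pair => v (x.2, x.1)] : hilb C pair).

Definition sym_subspace : {vspace hilb C pair} := lker (swap_op - \1)%VF.
Definition antisym_subspace : {vspace hilb C pair} := lker (swap_op + \1)%VF.

(* Outcome [false] is the symmetric one, [true] the antisymmetric one. *)
Definition swap_proj (b : bool) : 'End(hilb C pair) :=
  orth_proj (if b then antisym_subspace else sym_subspace).

Definition ket (I : finType) (x : I) : hilb C I := [ffun y => (y == x)%:R].

(* The tensor product of N operators, the i-th one acting on the pair made of
   the sites i and N + i of a register of N + N qudits. *)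
Definition pairwise_tensor (N : nat) (P : 'I_N -> 'End(hilb C pair)) :
    'End(hilb C {ffun 'I_(N + N) -> 'I_d}) :=
  kerop (fun x y : {ffun 'I_(N + N) -> 'I_d} =>
    \prod_(i < N) braket (ket (x (lshift N i), x (rshift N i)))
                         (P i (ket (y (lshift N i), y (rshift N i))))).

Definition swap_test (N : nat) (s : {ffun 'I_N -> bool}) :
    'End(hilb C {ffun 'I_(N + N) -> 'I_d}) :=
  pairwise_tensor (fun i => swap_proj (s i)).

End SwapTest.

Section SpecialUnitary.
Variables (R : realType) (d : nat).

Definition SU_set : set 'M[(R[i])^o]_d :=
  [set U | (U : 'M[R[i]]_d) \is unitarymx /\ \det (U : 'M[R[i]]_d) = 1].

Definition SU : Type := set_type SU_set.

HB.instance Definition _ := Topological.copy SU (set_type SU_set).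
HB.instance Definition _ := Choice.copy SU (set_type SU_set).

Definition SU_mx (U : SU) : 'M[R[i]]_d := set_val U.

Fact SU_mul_subproof (U V : SU) : SU_set (SU_mx U *m SU_mx V).
Proof.
have /set_mem[Uu dU] := valP U; have /set_mem[Vu dV] := valP V.
by split; [exact: mul_unitarymx | rewrite det_mulmx dU dV mulr1].
Qed.

Definition SU_mul (U V : SU) : SU :=
  exist _ (SU_mx U *m SU_mx V) (mem_set (SU_mul_subproof U V)).

Fact SU_one_subproof : SU_set (1%:M : 'M[R[i]]_d).
Proof.
by split; [apply/unitarymxP; rewrite trmx1 map_mx1 mulmx1 | exact: det1].
Qed.

Definition SU_one : SU := exist _ (1%:M : 'M[R[i]]_d) (mem_set SU_one_subproof).

HB.instance Definition _ := isPointed.Build SU SU_one.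

Definition borelSU := g_sigma_algebraType (@open SU).

HB.instance Definition _ := Measurable.on borelSU.

(* Normalized Haar measure: on the compact group SU(d), left invariance
   characterizes it among the Borel probability measures. *)
Definition is_haar (mu : probability borelSU R) : Prop :=
  forall (V : SU) (A : set SU), measurable (A : set borelSU) ->
    mu [set U | A (SU_mul V U)] = mu A.

End SpecialUnitary.

Section Overlap.
Variables (R : realType) (d : nat).

(* |Psi_U> = U^{(x)(N+M)} |psi>^{(x)N} (x) |phi>^{(x)M} *)
Definition Psi (N M : nat) (psi phi : hilb R[i] 'I_d) (U : SU R d) :
    hilb R[i] {ffun 'I_(N + M) -> 'I_d} :=
  tensor_pow (N + M) (SU_mx U)
    [ffun x : {ffun 'I_(N + M) -> 'I_d} =>
       \prod_(i < N) (psi (x (lshift M i)) : R[i]) *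
       \prod_(j < M) (phi (x (rshift N j)) : R[i])].

(* Pi_J for J = J_min + j, 0 <= j <= N; see [overlap_rows] for the row
   lengths. *)
Definition overlap_proj (N M : nat) (j : 'I_N.+1) :
    'End(hilb R[i] {ffun 'I_(N + M) -> 'I_d}) :=
  orth_proj (schur_weyl_block R[i] d (N + M) [:: (M + j)%N; (N - j)%N]).

(* <v|E|v>, which is real when E is an orthogonal projector
   ([outcome_probE]). *)
Definition outcome_prob (I : finType) (E : 'End(hilb R[i] I))
    (v : hilb R[i] I) : R :=
  complex.Re (braket v (E v)).

Definition avg_fidelity (mu : probability (borelSU R d) R) (N M : nat)
    (psi phi : hilb R[i] 'I_d) (K : finType)
    (E : K -> 'End(hilb R[i] {ffun 'I_(N + M) -> 'I_d})) : \bar R :=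
  \int[mu]_(U in [set: SU R d])
    (let v := Psi N M psi phi U in
     \sum_k normc (braket v (E k v)) ^+ 2)%:E.

Lemma outcome_probE (I : finType) (W : {vspace hilb R[i] I})
    (v : hilb R[i] I) :
  (outcome_prob (orth_proj W) v)%:C%C = braket v (orth_proj W v).
Proof.
have [_ _ sa] := orth_projP W; apply/RRe_real/CrealP.
rewrite -[in RHS]sa; rewrite /braket.
by rewrite [RHS](hermC (@hdot R[i] I)) expr0 mul1r.
Qed.

End Overlap.

Lemma overlap_rows (N M : nat) (j : 'I_N.+1) :
  let Jmin := (M%:R - N%:R) / 2 : rat in
  let Jmax := (M%:R + N%:R) / 2 : rat in
  let J := Jmin + j%:R in
  (M + j)%:R = Jmax + J /\ (N - j)%:R = Jmax - J.
Proof.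
have jN : (j <= N)%N by rewrite -ltnS.
by move=> Jmin Jmax J; rewrite natrD natrB // /J /Jmax /Jmin; split; field.
Qed.

(* Main.v *)
From HB Require Import structures.
Require Import Defs.
From mathcomp Require Import all_boot all_order all_fingroup all_algebra.
From mathcomp Require Import spectral sesquilinear complex.
From mathcomp Require Import all_classical all_reals all_analysis.
From mathcomp Require Import ring.

Set Implicit Arguments.
Unset Strict Implicit.
Unset Printing Implicit Defensive.

Import Order.TTheory GRing.Theory Num.Theory Num.Def.
Import Normc.

Local Open Scope classical_set_scope.
Local Open Scope ring_scope.
(* Every measurement operator here commutes with U^{(x)(N+M)}, so the integrand
   does not depend on U and the Haar average is trivial. For Pi_J this holds
   because U^{(x)n} and its adjoint commute with the Young symmetrizers, hence
   preserve the Schur-Weyl block and its orthogonal complement. For the swap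
   test the outcome probabilities factor over the pairs into (1 +- c)/2, since
   the single-pair projectors are (1 +- swap)/2. *)

(** * Kernel operators and orthogonal projectors *)

Section Operators.
Variables (C : numClosedFieldType) (I : finType).
Local Notation H := (hilb C I).

(** [linfun] accepts any function, but [lfunE] needs a canonical linear structure; here the
    structure is packed from the proof [lf]. *)
Lemma linfunE (V W : vectType C) (f : V -> W) : linear f -> linfun f =1 f.
Proof.
move=> lf; pose m := GRing.isLinear.Build C V W *:%R f lf.
pose F : {linear V -> W} := HB.pack f m.
exact: (lfunE F).
Qed.

Lemma keropE (k : I -> I -> C) (v : H) x :
  kerop k v x = \sum_y k x y * v y.
Proof.
rewrite /kerop linfunE ?ffunE // => a u w; apply/ffunP => z.
rewrite !ffunE scaler_sumr -big_split /=; apply: eq_bigr => y _.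
by rewrite !ffunE mulrDr; congr (_ + _); exact: mulrCA.
Qed.

Lemma kerop_adj (k : I -> I -> C) (u v : H) :
  braket u (kerop k v) = braket (kerop (fun x y => (k y x)^*) u) v.
Proof.
rewrite /braket /hdot.
under eq_bigr do rewrite keropE mulr_suml.
under [RHS]eq_bigr do rewrite keropE rmorph_sum mulr_sumr.
rewrite exchange_big /=; apply: eq_bigr => y _; apply: eq_bigr => x _.
by rewrite rmorphM /= conjCK mulrCA mulrA.
Qed.

Lemma orth_proj_unique (W : {vspace H}) (w w' : H) :
  w \in W -> w' \in orthov (@hdot C I) W -> orth_proj W (w + w') = w.
Proof.
move=> wW w'W; rewrite linearD /= [X in X + _]daddv_pi_id ?orthov_cap //.
rewrite [X in _ + X](_ : _ = 0) ?addr0 //.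
(* Split [w'] into its two components: the one in the orthogonal complement is [w'] itself, so the
   one in [W] is 0. *)
have := daddv_pi_add (orthov_cap W) (subvP (addvSr W _) _ w'W).
rewrite [X in _ + X]daddv_pi_id //; last by rewrite capvC orthov_cap.
by move=> /(canRL (addrK _)); rewrite subrr.
Qed.

(** Since the adjoint [T'] preserves [W], [T] preserves the orthogonal complement; as [T] also
    preserves [W], it acts on the two components of [v] separately. *)
Lemma orth_proj_comm (W : {vspace H}) (T T' : 'End(H)) :
  (forall u v, braket u (T v) = braket (T' u) v) ->
  (forall w, w \in W -> T w \in W) -> (forall w, w \in W -> T' w \in W) ->
  forall v, orth_proj W (T v) = T (orth_proj W v).
Proof.
move=> adj TW T'W v.
have vE : v = orth_proj W v + daddv_pi (orthov (@hdot C I) W) W v.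
  by rewrite daddv_pi_add ?orthov_cap ?orthov_add ?memvf.
rewrite [in LHS]vE linearD /= orth_proj_unique //; first exact/TW/memv_pi.
apply/mem_orthovP => w wW.
have /mem_orthovP := memv_pi (orthov (@hdot C I) W) W v.
by move=> /(_ _ (T'W _ wW)) <-; exact: adj.
Qed.

End Operators.

(** * Tensor powers of matrices and invariance of the Schur-Weyl blocks *)

Section TensorPower.
Variables (C : numClosedFieldType) (d n : nat).
Local Notation reg := (hilb C {ffun 'I_n -> 'I_d}).
Implicit Types U V : 'M[C]_d.

Lemma tensor_powM U V (v : reg) :
  tensor_pow n U (tensor_pow n V v) = tensor_pow n (U *m V) v.
Proof.
apply/ffunP => x; rewrite !keropE.
under eq_bigr do rewrite keropE mulr_sumr.
rewrite exchange_big /=; apply: eq_bigr => y _.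
under eq_bigr do rewrite mulrA -big_split /=.
rewrite -mulr_suml; congr (_ * _).
under [RHS]eq_bigr do rewrite mxE.
by rewrite bigA_distr_bigA.
Qed.

Lemma tensor_pow1 (v : reg) : tensor_pow n 1%:M v = v.
Proof.
apply/ffunP => x; rewrite keropE (bigD1 x) //= [X in X * _]big1 => [|i _].
  rewrite mul1r big1 ?addr0 // => y yx.
  (* Distinct basis states differ at some site, where the entry of the identity matrix vanishes. *)
  have [i xy|e] := pickP (fun i => x i != y i); last first.
    by case/eqP: yx; apply/ffunP => i; have /negbFE/eqP := e i.
  by rewrite (bigD1 i) //= mxE (negbTE xy) !mul0r.
by rewrite mxE eqxx.
Qed.

Lemma tensor_pow_adj U (u v : reg) :
  braket u (tensor_pow n U v) = braket (tensor_pow n (U ^t* )%sesqui u) v.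
Proof.
rewrite kerop_adj; congr (braket _ _); apply/ffunP => x.
rewrite !keropE; apply: eq_bigr => y _; rewrite rmorph_prod; congr (_ * _).
by apply: eq_bigr => i _; rewrite !mxE.
Qed.

Lemma tensor_pow_unitary U (u v : reg) : U \is unitarymx ->
  braket (tensor_pow n U u) (tensor_pow n U v) = braket u v.
Proof.
move=> Uu; rewrite tensor_pow_adj tensor_powM.
by rewrite -[(U ^t*)%sesqui]invmx_unitary // mulVmx ?unitarymx_unit // tensor_pow1.
Qed.

Lemma perm_opE (s : 'S_n) (v : reg) x : perm_op C d s v x = v [ffun i => x (s i)].
Proof.
rewrite /perm_op linfunE ?ffunE // => a u w; apply/ffunP => z.
by rewrite !ffunE.
Qed.

(** The kernel of [tensor_pow n U] is unchanged when the sites of both of its arguments are permuted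
    alike, so it suffices to reindex the sum over [y] and the product over sites. *)
Lemma tensor_pow_perm U (s : 'S_n) (v : reg) :
  tensor_pow n U (perm_op C d s v) = perm_op C d s (tensor_pow n U v).
Proof.
apply/ffunP => x; rewrite perm_opE !keropE.
pose h (y : {ffun 'I_n -> 'I_d}) : {ffun 'I_n -> 'I_d} := [ffun i => y (s i)].
have hI : injective h.
  move=> y z /ffunP e; apply/ffunP => i.
  by have := e (s^-1%g i); rewrite !ffunE permKV.
rewrite [RHS](reindex_inj hI) /=; apply: eq_bigr => y _.
rewrite perm_opE (reindex_inj (@perm_inj _ s)) /=; congr (_ * _).
by apply: eq_bigr => i _; rewrite !ffunE.
Qed.

Lemma tensor_pow_young U t (v : reg) :
  tensor_pow n U (young_sym C d t v) = young_sym C d t (tensor_pow n U v).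
Proof.
rewrite /young_sym !comp_lfunE !sum_lfunE linear_sum /=.
apply: eq_bigr => s _; rewrite tensor_pow_perm linear_sum /=.
congr (perm_op _ _ _ _); apply: eq_bigr => r _.
by rewrite !scale_lfunE linearZ /= tensor_pow_perm.
Qed.

Lemma tensor_pow_block U sh (v : reg) :
  v \in schur_weyl_block C d n sh -> tensor_pow n U v \in schur_weyl_block C d n sh.
Proof.
move=> /memv_sumP[w wt ->]; rewrite linear_sum /=; apply: memv_sumr => t tt.
have /memv_imgP[z _ ->] := wt t tt.
by rewrite tensor_pow_young memv_img ?memvf.
Qed.

Lemma schur_weyl_proj_invariant U sh (v : reg) : U \is unitarymx ->
  let P := orth_proj (schur_weyl_block C d n sh) in
  braket (tensor_pow n U v) (P (tensor_pow n U v)) = braket v (P v).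
Proof.
move=> Uu P; rewrite /P (orth_proj_comm (T' := tensor_pow n (U ^t* )%sesqui)).
- exact: tensor_pow_unitary.
- by move=> u w; exact: tensor_pow_adj.
- by move=> w; exact: tensor_pow_block.
- by move=> w; exact: tensor_pow_block.
Qed.

End TensorPower.

(** * Outcome probabilities of the swap tests *)

Section SwapTestProbability.
Variables (C : numClosedFieldType) (d : nat).
Local Notation qudit := (hilb C 'I_d).
Local Notation pair := ('I_d * 'I_d)%type.
Implicit Types u w : qudit.

Lemma kerop_unitary (U : 'M[C]_d) u w : U \is unitarymx ->
  braket (kerop U u) (kerop U w) = braket u w.
Proof.
move=> Uu.
(* Orthonormality of the columns, whereas [unitarymx] is defined through the rows. *)
have UU x y : \sum_z (U z x)^* * U z y = (x == y)%:R.
  have : (U^t*)%sesqui *m U = 1%:M.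
    by rewrite -[(U^t*)%sesqui]invmx_unitary // mulVmx ?unitarymx_unit.
  move=> /(congr1 (fun A : 'M[C]_d => A x y)); rewrite !mxE => <-.
  by apply: eq_bigr => z _; rewrite !mxE.
rewrite kerop_adj; congr (braket _ _); apply/ffunP => x; rewrite keropE.
under eq_bigr do rewrite keropE mulr_sumr.
rewrite exchange_big /=.
under eq_bigr do under eq_bigr do rewrite mulrA.
under eq_bigr do rewrite -mulr_suml UU.
rewrite (bigD1 x) //= eqxx mul1r big1 ?addr0 // => y yx.
by rewrite eq_sym (negbTE yx) mul0r.
Qed.

(** Same body as the vector inside [Psi], so that the latter can be folded by conversion. *)
Definition product_state N M u w : hilb C {ffun 'I_(N + M) -> 'I_d} :=
  [ffun x : {ffun 'I_(N + M) -> 'I_d} =>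
     \prod_(i < N) (u (x (lshift M i)) : C) *
     \prod_(j < M) (w (x (rshift N j)) : C)].

Lemma tensor_pow_product N M (U : 'M[C]_d) u w :
  tensor_pow (N + M) U (product_state N M u w) =
  product_state N M (kerop U u) (kerop U w).
Proof.
(* Both blocks of factors become one family over all sites, so that the sum over basis states
   distributes as a single product. *)
pose f (i : 'I_(N + M)) : qudit := if fintype.split i is inl _ then u else w.
have fl i : f (lshift M i) = u by rewrite /f (unsplitK (inl i)).
have fr i : f (rshift N i) = w by rewrite /f (unsplitK (inr i)).
apply/ffunP => x; rewrite keropE ffunE.
transitivity (\prod_(i < N + M) \sum_k U (x i) k * f i k).
  rewrite bigA_distr_bigA /=; apply: eq_bigr => y _.
  rewrite big_split ffunE /=; congr (_ * _); rewrite big_split_ord /=.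
  by congr (_ * _); apply: eq_bigr => i _; rewrite ?fl ?fr.
rewrite big_split_ord /=.
by congr (_ * _); apply: eq_bigr => i _; rewrite keropE ?fl ?fr.
Qed.

Lemma swap_opE (v : hilb C pair) x : swap_op C d v x = v (x.2, x.1).
Proof.
rewrite /swap_op linfunE ?ffunE // => a u w; apply/ffunP => z.
by rewrite !ffunE.
Qed.

Lemma swap_opK : involutive (swap_op C d).
Proof. by move=> v; apply/ffunP => -[x y]; rewrite !swap_opE. Qed.

Lemma swap_op_adj (u v : hilb C pair) :
  braket u (swap_op C d v) = braket (swap_op C d u) v.
Proof.
have hI : injective (fun x : pair => (x.2, x.1)) by move=> [? ?] [? ?] [-> ->].
rewrite /braket /hdot (reindex_inj hI) /=; apply: eq_bigr => -[x y] _.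
by rewrite !swap_opE.
Qed.

(** With S the swap and e the sign of [b], v is the sum of (v + e S v)/2, an eigenvector for e, and
    (v - e S v)/2, which is orthogonal to that eigenspace because S is self-adjoint. *)
Lemma swap_projE b (v : hilb C pair) :
  swap_proj C d b v = 2^-1 *: (v + (-1) ^+ b *: swap_op C d v).
Proof.
set S := swap_op C d; set e := (-1) ^+ b.
pose W := if b then antisym_subspace C d else sym_subspace C d.
have WE z : (z \in W) = (S z == e *: z).
  rewrite /W /e; case: (b); rewrite memv_ker !lfunE /= ?lfunE /= ?lfunE /=.
    by rewrite expr1 scaleN1r addr_eq0.
  by rewrite expr0 scale1r subr_eq0.
have ee : e * e = 1 by rewrite /e -signr_addb addbb.
have vE : v = 2^-1 *: (v + e *: S v) + 2^-1 *: (v - e *: S v).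
  rewrite -scalerDr addrACA subrr addr0 -mulr2n -scaler_nat scalerA.
  by rewrite mulVf ?scale1r // pnatr_eq0.
rewrite {1}vE /swap_proj -/W orth_proj_unique //.
  rewrite WE !linearZ /= linearD /= linearZ /= swap_opK.
  by rewrite [e *: (_ + _)]scalerDr scalerA ee scale1r addrC.
apply/mem_orthovP => z; rewrite WE => /eqP Sz.
rewrite linearZl_LR /= linearBl /= linearZl_LR /=.
have := swap_op_adj z v; rewrite /braket -/S Sz linearZr_LR /= => ->.
by rewrite rmorph_sign mulrA ee mul1r subrr mulr0.
Qed.

Definition tensor2 u w : hilb C pair := [ffun p : pair => (u p.1 : C) * w p.2].

Lemma braket_tensor2 u1 u2 w1 w2 :
  braket (tensor2 u1 u2) (tensor2 w1 w2) = braket u1 w1 * braket u2 w2.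
Proof.
rewrite /braket /hdot big_distrlr /= pair_bigA /=; apply: eq_bigr => p _.
by rewrite !ffunE rmorphM /= mulrACA.
Qed.

(** The swap exchanges the two factors, so its expectation value is the product of [braket u w] and
    its conjugate. *)
Lemma swap_proj_tensor2 b u w : braket u u = 1 -> braket w w = 1 ->
  braket (tensor2 u w) (swap_proj C d b (tensor2 u w)) =
  2^-1 * (1 + (-1) ^+ b * `|braket u w| ^+ 2).
Proof.
move=> uu ww; rewrite swap_projE.
have -> : swap_op C d (tensor2 u w) = tensor2 w u.
  by apply/ffunP => p; rewrite swap_opE !ffunE mulrC.
have braketDr (I : finType) (x y z : hilb C I) :
  braket x (y + z) = braket x y + braket x z by rewrite /braket linearDl.
have braketZr (I : finType) a (x y : hilb C I) :
  braket x (a *: y) = a * braket x y by rewrite /braket linearZl_LR.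
rewrite braketZr braketDr braketZr !braket_tensor2 uu ww mulr1 normCK.
do !congr (_ * _); congr (_ + _ * (_ * _)).
by rewrite /braket (hermC (@hdot C 'I_d)) expr0 mul1r.
Qed.

(** Recovers the action of an operator from the matrix elements used in the kernel of
    [pairwise_tensor]. *)
Lemma braket_ket (I : finType) (A : 'End(hilb C I)) (v : hilb C I) x :
  \sum_y braket (ket C x) (A (ket C y)) * v y = A v x.
Proof.
have kE (z : hilb C I) : braket (ket C x) z = z x.
  rewrite /braket /hdot (bigD1 x) //= big1 ?addr0 => [|y yx].
    by rewrite ffunE eqxx conjC1 mulr1.
  by rewrite ffunE (negbTE yx) conjC0 mulr0.
have {2}-> : v = \sum_y v y *: ket C y.
  apply/ffunP => y; rewrite sum_ffunE (bigD1 y) //= big1 ?addr0 => [|z zy].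
    by rewrite !ffunE eqxx; apply/esym/mulr1.
  by rewrite !ffunE eq_sym (negbTE zy); apply: mulr0.
rewrite linear_sum sum_ffunE; apply: eq_bigr => y _.
by rewrite linearZ /= ffunE kE mulrC.
Qed.

Lemma pairwise_tensor_product N (P : 'I_N -> 'End(hilb C pair)) u w :
  let v := product_state N N u w in
  braket v (pairwise_tensor P v) =
  \prod_i braket (tensor2 u w) (P i (tensor2 u w)).
Proof.
move=> v; set t := tensor2 u w.
(* Reindexing along [g] regroups the sites [i] and [N + i] into pairs; the state then becomes a
   product of copies of [t], and the sums over pairs factor. *)
pose g (h : {ffun 'I_N -> pair}) : {ffun 'I_(N + N) -> 'I_d} :=
  [ffun k => match fintype.split k with inl i => (h i).1 | inr i => (h i).2 end].
have gl h i : g h (lshift N i) = (h i).1 by rewrite ffunE (unsplitK (inl i)).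
have gr h i : g h (rshift N i) = (h i).2 by rewrite ffunE (unsplitK (inr i)).
have gbij : bijective g.
  exists (fun x : {ffun 'I_(N + N) -> 'I_d} =>
    [ffun i => (x (lshift N i), x (rshift N i))]) => [h|x].
    by apply/ffunP => i; rewrite ffunE gl gr -surjective_pairing.
  apply/ffunP => k; rewrite -[k]splitK.
  by case: (fintype.split k) => i /=; rewrite ?gl ?gr ffunE.
have vg h : v (g h) = \prod_i t (h i).
  rewrite ffunE -big_split /=; apply: eq_bigr => i _.
  by rewrite gl gr ffunE.
rewrite {1}/braket /hdot (reindex g) /=; last exact: onW_bij.
rewrite bigA_distr_bigA /=; apply: eq_bigr => h _.
rewrite vg rmorph_prod big_split /=; congr (_ * _).
rewrite keropE (reindex g) /=; last exact: onW_bij.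
under [RHS]eq_bigr do rewrite -braket_ket.
rewrite bigA_distr_bigA /=; apply: eq_bigr => h' _.
rewrite vg -big_split /=; apply: eq_bigr => i _.
by rewrite !gl !gr -!surjective_pairing.
Qed.

End SwapTestProbability.

(** * Haar averages of constant integrands and the two fidelities *)

Lemma avg_fidelity_const (R : realType) (d N M : nat)
    (mu : probability (borelSU R d) R) (psi phi : hilb R[i] 'I_d) (K : finType)
    (E : K -> 'End(hilb R[i] {ffun 'I_(N + M) -> 'I_d})) (p : K -> R) :
  (forall U k, braket (Psi N M psi phi U) (E k (Psi N M psi phi U)) = (p k)%:C%C) ->
  avg_fidelity mu psi phi E = (\sum_k p k ^+ 2)%:E.
Proof.
move=> pE; have -> : avg_fidelity mu psi phi E =
    (\int[mu]_(U in [set: SU R d]) (\sum_k p k ^+ 2)%:E)%E.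
  apply: eq_integral => U _; congr (_%:E); apply: eq_bigr => k _.
  (* The expectation value is real, so [normc] unfolds to the square root of [p k ^+ 2 + 0]. *)
  by rewrite pE /normc /= expr0n addr0 sqr_sqrtr ?sqr_ge0.
rewrite integral_cst; last exact: (@measurableT _ (borelSU R d)).
by rewrite [X in (_ * X)%E](probability_setT mu) mule1.
Qed.

Theorem mainTheorem11 (R : realType) (d : nat) (hd : (2 <= d)%N)
    (mu : probability (borelSU R d) R) (hmu : is_haar mu)
    (psi phi : hilb R[i] 'I_d) (c : R)
    (hpsi : braket psi psi = 1) (hphi : braket phi phi = 1)
    (hc : normc (braket psi phi) ^+ 2 = c) :
  (forall N M : nat, (1 <= N)%N -> (N <= M)%N ->
     avg_fidelity mu psi phi (@overlap_proj R d N M) =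
     (\sum_(j < N.+1)
        outcome_prob (overlap_proj R d M j) (Psi N M psi phi (SU_one R d)) ^+ 2)%:E) /\
  (forall N : nat, (1 <= N)%N ->
     avg_fidelity mu psi phi (@swap_test R[i] d N) = (((1 + c ^+ 2) / 2) ^+ N)%:E).
Proof.
have unitary (U : SU R d) : SU_mx U \is unitarymx by have /set_mem[] := valP U.
split=> [N M _ _|N _].
  apply: avg_fidelity_const => U j; rewrite outcome_probE /overlap_proj /Psi.
  (* Applied on both sides: the values at [U] and at [SU_one] both reduce to that of the
     untransformed product state. *)
  by rewrite !schur_weyl_proj_invariant.
(* The probability of outcome [b] in a single swap test. *)
pose q (b : bool) : R := 2^-1 * (1 + (-1) ^+ b * c).
rewrite (@avg_fidelity_const _ _ _ _ _ _ _ _ _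
  (fun s : {ffun 'I_N -> bool} => \prod_i q (s i))).
  congr (_%:E); under eq_bigr do rewrite -prodrXl.
  (* The sum over all outcome strings factors over the pairs; each factor is ((1 + c)/2)^2 + ((1 -
     c)/2)^2 = (1 + c^2)/2. *)
  rewrite -(bigA_distr_bigA (fun (i : 'I_N) b => q b ^+ 2)) /=.
  rewrite prodr_const card_ord; congr (_ ^+ _).
  by rewrite big_bool /q /= expr0 expr1; field.
move=> U s; rewrite /Psi /swap_test.
rewrite (_ : [ffun x => _] = product_state N N psi phi) //.
rewrite tensor_pow_product pairwise_tensor_product rmorph_prod.
apply: eq_bigr => i _; rewrite swap_proj_tensor2 ?kerop_unitary //.
rewrite /q -hc -[RHS]/(real_complex R _) rmorphM fmorphV rmorph_nat rmorphD.
by rewrite rmorphM rmorph1 rmorph_sign rmorphXn.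
Qed.
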